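(* Let $q=p^h$ with $p$ prime. Let $B$ be a minimal blocking set with respect to lines in $PG(2,q)$ with $|B|=q+k$, where $k<(q+3)/2$. Suppose there is a line $L$ with $|L\cap B|=k$. Then $v_B-v_L$ is a codeword of $C(PG(2,q))^\perp$ of weight $2q+1-k$, where $v_B,v_L$ are the incidence vectors of $B$ and $L$.
   Context: $C(PG(2,q))$ is the $\mathbb{F}_p$-span of the incidence vectors of the lines of $PG(2,q)$, with coordinates indexed by points. $C^\perp$ is its dual with respect to the standard scalar product over $\mathbb{F}_p$. A blocking set with respect to lines is a point set meeting every line. It is minimal if no proper subset is a blocking set. *)

(* Defs.v *)
From HB Require Import structures.
From mathcomp Require Import all_boot all_order all_algebra all_field.
Set Implicit Arguments. Unset Strict Implicit. Unset Printing Implicit Defensive.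
Import GRing.Theory.
Local Open Scope ring_scope.

Definition normalized (F : finFieldType) (v : 'rV[F]_3) : bool :=
  [exists i : 'I_3, (v 0 i == 1) && [forall j : 'I_3, (j < i)%N ==> (v 0 j == 0)]].

(* Points of PG(2,F): one normalized representative per 1-dim subspace of F^3. *)
Definition pg_point (F : finFieldType) := {v : 'rV[F]_3 | normalized v}.
(* Lines of PG(2,F): given by normalized dual coordinates. *)
Definition pg_line (F : finFieldType) := {v : 'rV[F]_3 | normalized v}.

Definition incident (F : finFieldType) (x : pg_point F) (l : pg_line F) : bool :=
  \sum_(i < 3) (val x) 0 i * (val l) 0 i == 0.

Definition blocking_set (F : finFieldType) (B : {set pg_point F}) : Prop :=
  forall l : pg_line F, exists2 x, x \in B & incident x l.

Definition minimal_blocking_set (F : finFieldType) (B : {set pg_point F}) : Prop :=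
  blocking_set B /\ forall B' : {set pg_point F}, B' \proper B -> ~ blocking_set B'.

Notation pvec F p := {ffun pg_point F -> 'F_p}.

Definition incvec (F : finFieldType) (p : nat) (S : {set pg_point F}) : pvec F p :=
  [ffun x => ((x \in S) : nat)%:R].

Definition line_set (F : finFieldType) (l : pg_line F) : {set pg_point F} :=
  [set x | incident x l].

Definition dotp (F : finFieldType) (p : nat) (v w : pvec F p) : 'F_p :=
  \sum_x v x * w x.

Definition in_code (F : finFieldType) (p : nat) (c : pvec F p) : Prop :=
  exists a : pg_line F -> 'F_p,
    forall x : pg_point F, c x = \sum_(l : pg_line F) a l * incvec p (line_set l) x.

Definition in_dual_code (F : finFieldType) (p : nat) (w : pvec F p) : Prop :=
  forall c : pvec F p, in_code c -> dotp w c = 0.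

Definition weight (F : finFieldType) (p : nat) (w : pvec F p) : nat :=
  #|[set x | w x != 0]|.

(* Main.v *)
Require Import Defs.
From HB Require Import structures.
From mathcomp Require Import all_boot all_order all_algebra all_field.
From mathcomp Require Import mxabelem zify ring.
Set Implicit Arguments. Unset Strict Implicit. Unset Printing Implicit Defensive.
Import GRing.Theory.
Local Open Scope ring_scope.

(* Seen from the line L at infinity, U = B \ L is a set of q affine points. A line through a point
   of L outside B meets U in exactly one point. For P in B on L, the Redei polynomial
   prod_u (X + a(u) Y - b(u)) in affine coordinates a, b centred at another point Q of L (taken
   in B if possible) equals X^q - X at all but at most max(k - 1, 1) values of Y. Hence its
   coefficients of X^i with k <= i < q vanish (1 < i if k = 1), and specialising Y to the
   direction P gives a lacunary fully reducible polynomial s = X^q + g. Since s divides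
   (X + g) g', degrees leave only g = -X, which minimality of B excludes, or g' = 0, where all
   root multiplicities, that is all |U :&: l| for l through P, are divisible by p. So every line
   other than L meets B in 1 mod p points, and summing over the pencil at a point of U settles L. *)

(** * Lacunary fully reducible polynomials *)

(** Induction with the product rule: for s = (X - c) t one has f s' = f t + (X - c) f t', where X -
    c divides f and t divides f t'. *)
Lemma prod_XsubC_dvdp_mul_deriv (R : fieldType) (cs : seq R) (f : {poly R}) :
  all (root f) cs ->
  \prod_(c <- cs) ('X - c%:P) %| f * (\prod_(c <- cs) ('X - c%:P))^`().
Proof.
elim: cs => [|c cs IH] /=; first by rewrite big_nil dvd1p.
case/andP=> fc fcs; rewrite big_cons; set t := \prod_(_ <- _) _ in IH *.
rewrite derivM derivXsubC mul1r mulrDr dvdp_add //.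
  by rewrite dvdp_mul2r ?monic_neq0 ?monic_prod_XsubC // dvdp_XsubCl.
by rewrite mulrCA dvdp_mul2l ?polyXsubC_eq0 ?IH.
Qed.

(** Write s = (X - a)^e t with t(a) nonzero. Cancelling (X - a)^(e - 1) in s' = 0 and evaluating at
    a leaves e t(a) = 0. *)
Lemma pchar_dvdn_count_mem (R : fieldType) (p : nat) (cs : seq R) (a : R) :
  p \in [pchar R] -> (\prod_(c <- cs) ('X - c%:P))^`() = 0 ->
  (p %| count_mem a cs)%N.
Proof.
move=> pR s'0; pose e := count_mem a cs.
pose t := \prod_(c <- cs | c != a) ('X - c%:P).
have ta : t.[a] != 0.
  rewrite horner_prod prodf_seq_neq0; apply/allP => c _; apply/implyP => ca.
  by rewrite !hornerE subr_eq0 eq_sym.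
have sE : \prod_(c <- cs) ('X - c%:P) = ('X - a%:P) ^+ e * t.
  rewrite (bigID (pred1 a)) /=; congr (_ * _).
  rewrite (eq_bigr (fun=> 'X - a%:P)) => [|c /eqP-> //].
  by rewrite big_const_seq iter_mulr_1.
rewrite -/e (dvdn_pcharf pR); case: e => [//|e] in sE *.
move: s'0; rewrite {}sE derivM deriv_exp derivXsubC mul1r exprS /=.
rewrite -mulrA mulrCA mulrnAl -mulrnAr -mulrDr.
move/eqP; rewrite mulf_eq0 expf_eq0 polyXsubC_eq0 andbF /=.
move/eqP/(congr1 (horner^~ a)); rewrite !hornerE subrr mul0r addr0.
by move/eqP; rewrite hornerMn -mulr_natr mulf_eq0 (negPf ta).
Qed.

(** Translation by 1 permutes F, so the sum of all elements equals itself plus q. *)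
Lemma natr_card_finField (F : finFieldType) : #|F|%:R = 0 :> F.
Proof.
apply: (addrI (\sum_(x : F) x)); rewrite addr0.
rewrite [RHS](reindex_inj (addIr 1)) big_split /= sumr_const.
by congr (_ + _%:R); apply: eq_card.
Qed.

Lemma fully_reducible_lacunary (F : finFieldType) (cs : seq F) (m : nat) :
    size cs = #|F| -> (0 < m)%N -> (2 * m <= #|F|)%N ->
    (forall i, (m < i < #|F|)%N -> (\prod_(c <- cs) ('X - c%:P))`_i = 0) ->
  \prod_(c <- cs) ('X - c%:P) = 'X^#|F| - 'X \/
  (\prod_(c <- cs) ('X - c%:P))^`() = 0.
Proof.
move=> scs m0 mq s0; set s := \prod_(_ <- _) _ in s0 *; set q := #|F| in scs mq s0 *.
have size_s : size s = q.+1 by rewrite size_prod_XsubC scs.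
have lead_s : s`_q = 1.
  by have /monicP := monic_prod_XsubC cs xpredT id; rewrite /lead_coef size_s.
pose g := s - 'X^q.
have size_g : (size g <= m.+1)%N.
  apply/leq_sizeP => j mj; rewrite coefB coefXn.
  case: ltngtP => [jq|jq|->]; last by rewrite lead_s subrr.
    by rewrite s0 ?subrr ?mj.
  by rewrite nth_default ?subrr ?size_s.
have q0 : q%:R = 0 :> {poly F} by rewrite -polyC_natr natr_card_finField.
have s'E : s^`() = g^`() by rewrite derivB derivXn -mulr_natr q0 mulr0 subr0.
(* At a root c of s, g(c) = -c^q = -c, so X + g vanishes there. *)
have dvd_s : s %| ('X + g) * s^`().
  apply: prod_XsubC_dvdp_mul_deriv; apply/allP => c c_cs.
  have /rootP sc0 : root s c by rewrite root_prod_XsubC.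
  by rewrite rootE /g !hornerE sc0 expf_card /= addr0 subrr.
have [g0|Xg0] := eqVneq ('X + g) 0.
  by left; rewrite -['X^_]addr0 -{}g0 /g; ring.
right; apply/eqP; case: eqVneq => // s'0.
(* The product on the right has size at most 2m, while s has size q + 1 > 2m. *)
have := dvdp_leq (mulf_neq0 Xg0 s'0) dvd_s.
rewrite size_mul // size_s.
have : (size ('X + g)%R <= m.+1)%N.
  by rewrite (leq_trans (size_polyD _ _)) // size_polyX geq_max size_g !ltnS m0.
have : (size s^`() <= m)%N.
  rewrite s'E; have [->|g0] := eqVneq g 0; first by rewrite linear0 size_poly0.
  by have := leq_trans (lt_size_deriv g0) size_g.
move: (size _) (size _) => a b; lia.
Qed.

(** * The Redei polynomial and its lacunarity *)

(** The outer variable is X; the coefficients are polynomials in Y. *)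
Definition redei_poly (R : comNzRingType) (ps : seq (R * R)) : {poly {poly R}} :=
  \prod_(u <- ps) ('X + (u.1 *: 'X - u.2%:P)%:P).

(** Every factor has total degree at most 1 in X and Y. Where the truncated bound is 0, it says that
    the coefficient vanishes. *)
Lemma size_coef_redei_poly (R : comNzRingType) (ps : seq (R * R)) (i : nat) :
  (size ((redei_poly ps)`_i)%R <= (size ps).+1 - i)%N.
Proof.
rewrite /redei_poly; elim: ps i => [|u ps IH] i.
  by rewrite big_nil coef1; case: i => [|i]; rewrite ?size_poly1 ?size_poly0.
rewrite big_cons /= mulrDl coefD coefXM coefCM.
rewrite (leq_trans (size_polyD _ _)) // geq_max; apply/andP; split.
  by case: i => [|i] /=; rewrite ?size_poly0 // (leq_trans (IH _)) //; lia.
set t := \prod_(_ <- _) _ in IH *.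
(* A zero coefficient is treated apart: the bound for products would only give size at most 1, where
   0 may be needed. *)
have [->|ti] := eqVneq t`_i 0; first by rewrite mulr0 size_poly0.
have := IH i; have : (0 < size (t`_i)%R)%N by rewrite size_poly_gt0.
have : (size (u.1 *: 'X - u.2%:P)%R <= 2)%N.
  rewrite (leq_trans (size_polyD _ _)) // geq_max size_polyN.
  rewrite (leq_trans (size_scale_leq _ _)) ?size_polyX //.
  by rewrite (leq_trans (size_polyC_leq1 _)).
have := size_polyMleq (u.1 *: 'X - u.2%:P) t`_i.
move: (size _) (size _) (size _) => a b c; lia.
Qed.

Lemma redei_poly_eval (R : comNzRingType) (ps : seq (R * R)) (y : R) (i : nat) :
  ((redei_poly ps)`_i).[y] = (\prod_(u <- ps) ('X - (u.2 - y * u.1)%:P))`_i.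
Proof.
rewrite -horner_evalE -coef_map rmorph_prod; congr (nth 0 (polyseq _) i).
apply: eq_bigr => u _.
rewrite rmorphD /= map_polyX map_polyC /= horner_evalE !hornerE.
by rewrite -polyCN opprB mulrC.
Qed.

(* For y outside D, R(X, y) = X^q - X, so for |D| < i < q the coefficient of X^i, of degree at
   most q - i in Y, has at least q - |D| roots and is zero. *)
Lemma few_directions (F : finFieldType) (ps : seq (F * F)) (D : {set F}) :
    size ps = #|F| -> (0 < #|D|)%N -> (2 * #|D| <= #|F|)%N ->
    (forall y, y \notin D -> perm_eq [seq u.2 - y * u.1 | u <- ps] (enum F)) ->
  \prod_(u <- ps) ('X - u.2%:P) = 'X^#|F| - 'X \/
  (\prod_(u <- ps) ('X - u.2%:P))^`() = 0.
Proof.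
move=> sps D0 Dq perm_ps.
have snd_ps : \prod_(u <- ps) ('X - u.2%:P) = \prod_(c <- map snd ps) ('X - c%:P).
  by rewrite big_map.
rewrite snd_ps; apply: (fully_reducible_lacunary (m := #|D|)) => //.
  by rewrite size_map.
move=> i /andP[Di iq]; rewrite -snd_ps.
(* The product in the conclusion is the specialisation Y = 0. *)
have -> : \prod_(u <- ps) ('X - u.2%:P) = \prod_(u <- ps) ('X - (u.2 - 0 * u.1)%:P).
  by apply: eq_bigr => u _; rewrite mul0r subr0.
rewrite -redei_poly_eval.
suff -> : (redei_poly ps)`_i = 0 by rewrite horner0.
apply/eqP; case: eqVneq => // Ri0.
have := @max_poly_roots _ _ (enum (~: D)) Ri0.
have -> : all (root (redei_poly ps)`_i) (enum (~: D)).
  apply/allP => y; rewrite mem_enum inE => /perm_ps yD; rewrite rootE redei_poly_eval.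
  rewrite -(big_map (fun u => u.2 - y * u.1) xpredT (fun c => 'X - c%:P)).
  rewrite (perm_big _ yD) /= big_enum /= -finField_genPoly coefB coefXn coefX.
  (* Since D is nonempty, i > 1, so i avoids both exponents of X^q - X. *)
  by rewrite (ltn_eqF iq) (gtn_eqF (leq_ltn_trans D0 Di)) // subr0.
rewrite enum_uniq -cardE => /(_ isT isT).
have cD : (#|D| + #|~: D|)%N = #|F| := cardsC D.
have := size_coef_redei_poly ps i; rewrite sps.
move=> zle zgt; have := leq_trans zgt zle.
by rewrite ltn_subRL ltnS -cD leq_add2r leqNgt Di.
Qed.

Lemma card_gt1_neq (T : finType) (A : {set T}) (x : T) :
  (1 < #|A|)%N -> exists2 y, y \in A & y != x.
Proof.
case/card_gt1P=> y [z [yA zA yz]]; have [<-|yx] := eqVneq y x; last by exists y.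
by exists z; rewrite // eq_sym.
Qed.

(** * Counting and incidence in the projective plane *)

Section ProjectivePlane.

Variable F : finFieldType.
Implicit Types (x y : pg_point F) (l m : pg_line F) (v w : 'rV[F]_3).

Definition dot v w : F := \sum_(i < 3) v 0 i * w 0 i.

Lemma dotE v w : dot v w = (v *m w^T) 0 0.
Proof. by rewrite mxE; apply: eq_bigr => i _; rewrite mxE. Qed.

Lemma dot_eq0 v w : (dot v w == 0) = (v *m w^T == 0).
Proof.
rewrite dotE; apply/eqP/eqP => [vw0|->]; last by rewrite mxE.
by apply/matrixP => i j; rewrite !ord1 vw0 mxE.
Qed.

Lemma dotDr u v w : dot u (v + w) = dot u v + dot u w.
Proof. by rewrite !dotE linearD mulmxDr mxE. Qed.

Lemma dotZr a v w : dot v (a *: w) = a * dot v w.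
Proof. by rewrite !dotE linearZ -scalemxAr mxE. Qed.

Lemma dotC v w : dot v w = dot w v.
Proof. by apply: eq_bigr => i _; rewrite mulrC. Qed.

Lemma incidentE x l : incident x l = (dot (val x) (val l) == 0).
Proof. by []. Qed.

Lemma incidentP {x l} : reflect (dot (val x) (val l) = 0) (incident x l).
Proof. exact: eqP. Qed.

Lemma incidentC x y : incident x y = incident y x.
Proof. by rewrite !incidentE dotC. Qed.

Lemma pg_neq0 x : val x != 0.
Proof.
have /existsP[i /andP[/eqP xi _]] := valP x.
by apply: contra_eq_neq xi => ->; rewrite mxE eq_sym oner_neq0.
Qed.

(** The scalar is the first nonzero coordinate of v. *)
Lemma pg_normalize v : v != 0 -> exists2 c, c != 0 & exists x, c *: val x = v.
Proof.
move=> v0; have /existsP[i0 vi0] : [exists i, v 0 i != 0].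
  apply: contraNT v0; rewrite negb_exists => /forallP v0; apply/eqP/rowP => i.
  by rewrite mxE; have := v0 i; rewrite negbK => /eqP.
have [i vi i_min] := @arg_minnP _ i0 (fun i => v 0 i != 0) (fun i => nat_of_ord i) vi0.
exists (v 0 i) => //.
have nv : normalized ((v 0 i)^-1 *: v).
  apply/existsP; exists i; rewrite mxE mulVf // eqxx /=.
  apply/forallP => j; apply/implyP => ji; rewrite mxE mulf_eq0.
  by apply/orP; right; apply: contraLR ji => /i_min; rewrite -leqNgt.
by exists (exist (fun v => normalized v) _ nv); rewrite /= scalerA mulfV // scale1r.
Qed.

(** Proportional vectors have their first nonzero entry in the same position; both entries are 1, so
    a = 1. *)
Lemma pg_scale_inj x y a : val x = a *: val y -> x = y.
Proof.
move=> xy; apply: val_inj.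
have /existsP[i /andP[/eqP xi /forallP xj]] := valP x.
have /existsP[j /andP[/eqP yj /forallP yk]] := valP y.
have ayi : a * val y 0 i = 1 by rewrite -xi xy mxE.
have a0 : a != 0 by apply: contra_eq_neq ayi => ->; rewrite mul0r eq_sym oner_neq0.
have ij : i = j.
  apply: ord_inj; case: (ltngtP i j) => // lt.
    have yi : val y 0 i = 0 by exact: eqP (implyP (yk i) lt).
    by move: ayi; rewrite yi mulr0 => /esym/eqP; rewrite oner_eq0.
  have xj0 : val x 0 j = 0 by exact: eqP (implyP (xj j) lt).
  have axj : val x 0 j = a by rewrite xy mxE yj mulr1.
  by rewrite -axj xj0 eqxx in a0.
by rewrite xy; move: ayi; rewrite ij yj mulr1 => ->; rewrite scale1r.
Qed.

(** The left kernel of A has dimension 3 - rank A, and each of its nonzero vectors is a nonzero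
    scalar times a point in a unique way. *)
Lemma card_pg_solutions (n : nat) (A : 'M[F]_(3, n)) :
  (#|F|.-1 * #|[set x : pg_point F | (val x *m A == 0)%R]| = (#|F| ^ (3 - \rank A)).-1)%N.
Proof.
set S := [set x | _]; pose f (cx : F * pg_point F) := cx.1 *: val cx.2.
have f_inj : {in setX [set~ 0] S &, injective f}.
  move=> [c x] [d y]; rewrite !in_setX !inE /= => /andP[c0 _] /andP[d0 _]; rewrite {}/f /= => fxy.
  have xy : x = y.
    apply: (@pg_scale_inj _ _ (c^-1 * d)).
    by rewrite -scalerA -fxy scalerA mulVf ?scale1r.
  congr (_, _) => //; apply/eqP; rewrite -subr_eq0.
  have : (c - d) *: val y == 0 by rewrite scalerBl subr_eq0 -fxy xy.
  by rewrite scaler_eq0 (negPf (pg_neq0 y)) orbF.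
have f_im : f @: setX [set~ 0] S = rowg (kermx A) :\ 0.
  apply/setP => v; rewrite in_setD1 mem_rowg sub_kermx.
  apply/imsetP/andP => [[[c x]]|[v0 /eqP vA]].
    rewrite in_setX !inE /= => /andP[c0 /eqP xA] ->.
    by rewrite scaler_eq0 negb_or c0 pg_neq0 -scalemxAl xA scaler0.
  have [c c0 [x cx]] := pg_normalize v0; exists (c, x) => //.
  rewrite in_setX !inE c0 /=.
  by move: vA; rewrite -cx -scalemxAl => /eqP; rewrite scaler_eq0 (negPf c0).
have := card_in_imset f_inj; rewrite f_im cardsX cardsC1 => <-.
have := cardsD1 0 (rowg (kermx A)); rewrite card_rowg mxrank_ker mem_rowg sub0mx.
by move=> ->.
Qed.

Lemma card_finField_gt1 : (1 < #|F|)%N.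
Proof. exact: finNzRing_gt1. Qed.

Lemma card_line_set l : #|line_set l| = #|F|.+1.
Proof.
have q1 := card_finField_gt1.
have := card_pg_solutions (val l)^T; rewrite mxrank_tr rank_rV pg_neq0.
have -> : [set x : pg_point F | val x *m (val l)^T == 0] = line_set l.
  by apply/setP => x; rewrite !inE incidentE dot_eq0.
set q := #|F| in q1 *; case: q q1 => [//|[//|q]] _ /= E.
by apply/eqP; rewrite -(eqn_pmul2l (ltn0Sn q)) E; apply/eqP; lia.
Qed.

Lemma rank_pg_pair x y : x != y -> \rank (col_mx (val x) (val y)) = 2.
Proof.
move=> xy; apply/eqP; rewrite eqn_leq rank_leq_row ltnNge; apply: contra xy => rk1.
have sub : (val y <= col_mx (val x) (val y))%MS by rewrite -addsmxE addsmxSr.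
have := mxrank_leqif_sup sub; rewrite rank_rV pg_neq0 /= => -[rk2].
rewrite eqn_leq rk2 rk1 -addsmxE addsmx_sub => /esym/andP[/sub_rVP[a xy] _].
exact/eqP/(pg_scale_inj xy).
Qed.

Lemma card_pg_pair x y : x != y -> #|[set l : pg_line F | incident x l & incident y l]| = 1%N.
Proof.
move=> xy; have q1 := card_finField_gt1.
have := card_pg_solutions (col_mx (val x) (val y))^T.
rewrite mxrank_tr (rank_pg_pair xy) expn1 tr_col_mx.
have -> : [set l : pg_point F | val l *m row_mx (val x)^T (val y)^T == 0] =
    [set l : pg_line F | incident x l & incident y l].
  apply/setP => l; rewrite !inE !(incidentC _ l) !incidentE !dot_eq0 mul_mx_row.
  apply/eqP/andP => [|[/eqP-> /eqP->]]; last by rewrite row_mx0.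
  by rewrite -row_mx0 => /eq_row_mx[-> ->].
move=> E; apply/eqP; rewrite -(@eqn_pmul2l #|F|.-1) ?E ?muln1 //.
by case: #|F| q1 => [|[]].
Qed.

(** Dual of [card_pg_pair]: points and lines have the same coordinates and incidence is
    symmetric. *)
Lemma pg_lines_meet l m : l != m ->
  exists2 x, incident x l && incident x m &
    forall y, incident y l -> incident y m -> y = x.
Proof.
move=> /card_pg_pair/eqP/cards1P[x xE]; exists x.
  by have := set11 x; rewrite -xE inE !(incidentC _ x).
by move=> y yl ym; apply/set1P; rewrite -xE inE !(incidentC _ y) yl.
Qed.

Lemma line_through_neq x l : exists2 m, incident x m & m != l.
Proof.
have [|m] := @card_gt1_neq _ (line_set x) l; last by rewrite inE incidentC; exists m.
by rewrite card_line_set ltnS ltnW ?card_finField_gt1.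
Qed.

(** The vectors orthogonal to x form a space of dimension 2, which two distinct lines through x
    already span. *)
Lemma pencil_span x l m t : incident x l -> incident x m -> incident x t -> l != m ->
  exists c d, val t = c *: val l + d *: val m.
Proof.
move=> xl xm xt lm.
have sub : (col_mx (val l) (val m) <= kermx (val x)^T)%MS.
  rewrite sub_kermx mul_col_mx; move: xl xm.
  by rewrite !(incidentC x) !incidentE !dot_eq0 => /eqP-> /eqP->; rewrite col_mx0.
have := mxrank_leqif_sup sub.
rewrite rank_pg_pair // mxrank_ker mxrank_tr rank_rV pg_neq0 => -[_ /esym kerS].
have : (val t <= col_mx (val l) (val m))%MS.
  by apply: submx_trans kerS; rewrite sub_kermx -dot_eq0 dotC.
rewrite -addsmxE => /sub_addsmxP[[u v] /= ->].
exists (u 0 0), (v 0 0); rewrite {1}[u]mx11_scalar {1}[v]mx11_scalar.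
by rewrite !mul_scalar_mx.
Qed.

End ProjectivePlane.

(** * Blocking sets with q points off a line *)

Section RedeiType.

Variables (F : finFieldType) (B : {set pg_point F}) (L : pg_line F).
Hypothesis blockB : blocking_set B.

Let U := B :\: line_set L.
Hypothesis card_affine : #|U| = #|F|.

(** With L at infinity this is an affine function of u, independent of the representative of u. Its
    level sets are cut out by the vectors v - z L. *)
Definition affine_coord (v : 'rV[F]_3) (u : pg_point F) : F :=
  dot (val u) v / dot (val u) (val L).

Let coords v := [seq affine_coord v u | u <- enum U].

Lemma affine_pointP u : u \in U -> dot (val u) (val L) != 0.
Proof. by rewrite !inE => /andP[]. Qed.

Lemma perm_coords_enum v : (forall z, z \in coords v) -> perm_eq (coords v) (enum F).
Proof.
move=> vF; have sub : {subset enum F <= coords v} by [].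
have szle : (size (coords v) <= size (enum F))%N.
  by rewrite size_map -!cardE card_affine.
apply: uniq_perm; rewrite ?enum_uniq //.
  exact: leq_size_uniq (enum_uniq F) sub szle.
by have [_ e] := uniq_min_size (enum_uniq F) sub szle; move=> z; rewrite e.
Qed.

Lemma affine_coord_inj v :
  perm_eq (coords v) (enum F) -> {in U &, injective (affine_coord v)}.
Proof.
by move=> pv; apply/dinjectiveP; rewrite /dinjectiveb (perm_uniq pv) enum_uniq.
Qed.

(** For each z, B meets the line v - z L. It does so off L, because v vanishes at no point of B on
    L. So all q values occur on the q points of U. *)
Lemma perm_affine_coord (v : 'rV[F]_3) :
    (forall b, b \in B -> incident b L -> dot (val b) v != 0) ->
  perm_eq (coords v) (enum F).
Proof.
move=> nov.
apply: perm_coords_enum => z; pose w := v - z *: val L.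
have dotw (b : pg_point F) : dot (val b) w = dot (val b) v - z * dot (val b) (val L).
  by rewrite /w -scaleNr dotDr dotZr mulNr.
(* B meets L at a point where v does not vanish, so v is no multiple of L. *)
have w0 : w != 0.
  have [b bB bL] := blockB L; have bv := nov b bB bL.
  apply: contraNneq bv => w0; have := dotw b.
  by rewrite w0 (incidentP bL) mulr0 subr0 -(scale0r v) dotZr mul0r => <-.
have [c c0 [l lw]] := pg_normalize w0; have [b bB bl] := blockB l.
have vz : dot (val b) v = z * dot (val b) (val L).
  by apply/eqP; rewrite -subr_eq0 -dotw -lw dotZr (incidentP bl) mulr0.
have bL : ~~ incident b L.
  by apply/negP => bL; have := nov b bB bL; rewrite vz (incidentP bL) mulr0 eqxx.
apply/mapP; exists b; first by rewrite mem_enum !inE bL.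
by rewrite /affine_coord vz mulfK.
Qed.

(** Dividing the equation of t by that of L turns it into the condition that the l-coordinate is
    -d/c. *)
Lemma card_affine_line (l t : pg_line F) (c d : F) :
  c != 0 -> val t = c *: val l + d *: val L ->
  #|U :&: line_set t| = count_mem (- (d / c)) (coords (val l)).
Proof.
move=> c0 tE; rewrite count_map.
have -> : #|U :&: line_set t| = count (mem (line_set t)) (enum U).
  have Ut : uniq [seq u <- enum U | u \in line_set t] by rewrite filter_uniq ?enum_uniq.
  rewrite -size_filter -(card_uniqP Ut); apply: eq_card => u.
  by rewrite mem_filter mem_enum in_setI andbC.
apply: eq_in_count => u; rewrite mem_enum => /affine_pointP uL.
have lE : dot (val u) (val l) = affine_coord (val l) u * dot (val u) (val L).
  by rewrite /affine_coord divfK.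
rewrite /= inE incidentE tE dotDr !dotZr lE mulrA -mulrDl mulf_eq0 (negPf uL) orbF.
rewrite addr_eq0; apply/eqP/eqP => [cE|->]; last by field.
by apply: (mulfI c0); rewrite cE; field.
Qed.

Lemma card_affine_line0 (l : pg_line F) :
  #|U :&: line_set l| = count_mem 0 (coords (val l)).
Proof.
rewrite (@card_affine_line l l 1 0) ?oner_neq0 ?mul0r ?oppr0 //.
by rewrite scale1r scale0r addr0.
Qed.

Lemma card_affine_line_nondirection (l : pg_line F) :
  (forall b, b \in B -> incident b L -> ~~ incident b l) ->
  #|U :&: line_set l| = 1%N.
Proof.
move=> noP; rewrite card_affine_line0 (permP (perm_affine_coord noP)).
by rewrite count_uniq_mem ?enum_uniq ?mem_enum.
Qed.

Variable p : nat.
Hypotheses (pF : p \in [pchar F]) (minB : minimal_blocking_set B).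
Hypothesis smallB : (2 * #|B :&: line_set L| < #|F| + 3)%N.

Lemma card_affine_line_direction (l : pg_line F) (P : pg_point F) :
  l != L -> P \in B -> incident P L -> incident P l ->
  (p %| #|U :&: line_set l|)%N.
Proof.
move=> lL PB PL Pl.
have q1 : (1 < #|F|)%N := card_finField_gt1 F.
have meetP x : incident x l -> incident x L -> x = P.
  move=> xl xL; have [y _ yu] := pg_lines_meet lL.
  by rewrite (yu x) // (yu P).
(* Taking Q in B when k > 1 leaves k - 1 directions, and [smallB] gives 2 (k - 1) <= q. When k = 1
   at most one direction remains, and 2 <= q. *)
have [Q [QP QL Qk]] : exists Q, [/\ Q != P, incident Q L &
    (1 < #|B :&: line_set L|)%N -> Q \in B].
  have [k1|k1] := ltnP 1 #|B :&: line_set L|.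
    by have [Q] := card_gt1_neq P k1; rewrite !inE => /andP[QB QL] QP; exists Q.
  have [|Q] := @card_gt1_neq _ (line_set L) P; first by rewrite card_line_set ltnS ltnW.
  by rewrite inE => QL QP; exists Q.
have [a Qa aL] := line_through_neq Q L.
have meetQ x : incident x a -> incident x L -> x = Q.
  move=> xa xL; have [y _ yu] := pg_lines_meet aL.
  by rewrite (yu x) // (yu Q).
pose S := (B :&: line_set L) :\ Q.
(* The vector l - y a vanishes at a point x of L other than Q exactly for y = [slope x], and never
   at Q. The direction P has slope 0. *)
pose slope (x : pg_point F) : F := dot (val x) (val l) / dot (val x) (val a).
pose D := slope @: S.
have D0 : (0 < #|D|)%N.
  by apply/card_gt0P; exists (slope P); rewrite imset_f // !inE eq_sym QP PB.
have Dq : (2 * #|D| <= #|F|)%N.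
  have DS : (#|D| <= #|S|)%N := leq_imset_card _ _.
  have kS := cardsD1 Q (B :&: line_set L); rewrite -/S in kS.
  have [k1|k1] := ltnP 1 #|B :&: line_set L|.
    rewrite in_setI Qk // inE QL in kS.
    have arith (d s q : nat) : (d <= s -> 2 * (1 + s) < q + 3 -> 2 * d <= q)%N by clear; lia.
    by apply: arith DS _; rewrite -kS.
  have S1 : (#|S| <= 1)%N by rewrite (leq_trans _ k1) // kS leq_addl.
  by rewrite (leq_trans _ q1) // -[X in (_ <= X)%N]muln1 leq_mul2l (leq_trans DS).
pose ps := [seq (affine_coord (val a) u, affine_coord (val l) u) | u <- enum U].
have sps : size ps = #|F| by rewrite size_map -cardE.
have perm_ps y : y \notin D -> perm_eq [seq u.2 - y * u.1 | u <- ps] (enum F).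
  move=> yD; rewrite -map_comp.
  rewrite (eq_map (g := affine_coord (val l - y *: val a))) => [|u]; last first.
    by rewrite /= /affine_coord -scaleNr dotDr dotZr mulrDl !mulNr mulrA.
  apply: perm_affine_coord => b bB bL.
  rewrite -scaleNr dotDr dotZr mulNr subr_eq0; apply: contra yD => /eqP bE.
  have bQ : b != Q.
    apply: contraNneq QP => bQ; apply/eqP/meetP => //.
    by rewrite -bQ incidentE bE bQ (incidentP Qa) mulr0.
  apply/imsetP; exists b; first by rewrite !inE bQ bB.
  rewrite /slope bE mulfK //; apply: contra bQ => ba; exact/eqP/meetQ.
have prodE : \prod_(u <- ps) ('X - u.2%:P) = \prod_(c <- coords (val l)) ('X - c%:P).
  by rewrite !big_map.
have := few_directions sps D0 Dq perm_ps; rewrite {}prodE => -[tang|]; last first.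
  by rewrite card_affine_line0; exact: pchar_dvdn_count_mem.
exfalso.
(* If the product is X^q - X, every line through P other than L meets U. *)
have lF z : z \in coords (val l).
  by rewrite -root_prod_XsubC tang rootE !hornerE expf_card subrr.
have [k1|k1] := ltnP 1 #|B :&: line_set L|.
  (* For k > 1, minimality gives a line t meeting B only in P. It differs from L, which also
     contains Q in B, and so it would have to meet U. *)
  have /existsP[t /forallP tP] : [exists t : pg_line F,
      [forall b, (b \in B) && incident b t ==> (b == P)]].
    apply/contraT; rewrite negb_exists => /forallP no_t; exfalso.
    have [_ /(_ (B :\ P))] := minB; apply; first exact: properD1.
    move=> t; have := no_t t; rewrite negb_forall => /existsP[b].
    by rewrite negb_imply => /andP[/andP[bB bt] bP]; exists b; rewrite // !inE bP.
  have Pt : incident P t.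
    have [b bB bt] := blockB t; have := tP b.
    by rewrite bB bt /= => /eqP bP; rewrite -bP.
  have tL : t != L.
    apply: contraNneq QP => tL; have := tP Q.
    by rewrite Qk // tL QL.
  have [c [d tE]] := pencil_span Pl PL Pt lL.
  have c0 : c != 0.
    apply: contra tL => /eqP c0; apply/eqP/(@pg_scale_inj _ _ _ d).
    by rewrite tE c0 scale0r add0r.
  have := card_affine_line c0 tE; rewrite (_ : U :&: line_set t = set0); last first.
    apply/setP => b; rewrite !inE; apply/negbTE/negP => /andP[/andP[bL bB] bt].
    by have := tP b; rewrite bB bt /= => /eqP bP; rewrite bP PL in bL.
  rewrite cards0 => /esym/eqP; rewrite -leqn0 leqNgt -has_count has_pred1.
  by rewrite lF.
(* For k = 1, P is the only point of B on L, so the coordinate of any vector not vanishing at P is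
   injective on U. By [lF] so is the l-coordinate, although l contains P. No direction is left for a
   secant of U. *)
have BP b : b \in B -> incident b L -> b = P.
  move=> bB bL; apply/eqP; apply: contraTT k1 => bP; rewrite -ltnNge.
  by apply/card_gt1P; exists b, P; rewrite !inE bB PB bL PL.
have /card_gt1P[u1 [u2 [u1U u2U u12]]] : (1 < #|U|)%N by rewrite card_affine.
pose A := affine_coord (val a); pose b := affine_coord (val l).
have A12 : A u1 - A u2 != 0.
  rewrite subr_eq0; apply: contra u12 => /eqP A12; apply/eqP; apply: affine_coord_inj A12 => //.
  apply: perm_affine_coord => x xB xL; apply: contraNneq QP => xa.
  by rewrite -(BP x) // [x](meetQ x) // incidentE xa.
(* The direction of the secant through u1 and u2 is not in B. *)
pose y := (b u1 - b u2) / (A u1 - A u2); pose v := val l - y *: val a.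
have vE u : affine_coord v u = b u - y * A u.
  by rewrite /affine_coord /v -scaleNr dotDr dotZr mulrDl !mulNr mulrA.
have y0 : y != 0.
  rewrite mulf_eq0 invr_eq0 (negPf A12) orbF subr_eq0; apply: contra u12 => /eqP b12.
  by apply/eqP; apply: affine_coord_inj b12 => //; exact: perm_coords_enum.
have : u1 = u2; last by move/eqP; rewrite (negPf u12).
apply: (@affine_coord_inj v) => //; last first.
  apply/eqP; rewrite -subr_eq0 !vE; apply/eqP.
  by rewrite /y; field.
apply: perm_affine_coord => x xB xL; rewrite (BP x) //.
rewrite /v -scaleNr dotDr dotZr (incidentP Pl) add0r mulf_neq0 ?oppr_eq0 //.
by apply: contraNneq QP => Pa; rewrite -(meetQ P) // incidentE Pa.
Qed.

(** Let P be the common point of l and L. If P is in B, the count is 1 plus a multiple of p;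
    otherwise l meets B only in U, in one point. *)
Lemma card_small_blocking_set_line (l : pg_line F) :
  l != L -> #|B :&: line_set l| = 1 %[mod p].
Proof.
move=> lL; have [P /andP[Pl PL] uP] := pg_lines_meet lL.
rewrite -(cardsID (line_set L)).
have -> : (B :&: line_set l) :\: line_set L = U :&: line_set l.
  by rewrite setIDAC.
have -> : B :&: line_set l :&: line_set L = B :&: [set P].
  apply/setP => x; rewrite !inE -andbA; congr (_ && _).
  by apply/andP/eqP => [[/uP]|->].
have [PB|PB] := boolP (P \in B).
  have -> : B :&: [set P] = [set P] by apply/setIidPr; rewrite sub1set.
  rewrite cards1; have /dvdnP[n ->] := card_affine_line_direction lL PB PL Pl.
  by rewrite addnC modnMDl.
have -> : B :&: [set P] = set0.
  apply/setP => x; rewrite !inE; apply/andP => -[xB /eqP xP].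
  by rewrite xP (negPf PB) in xB.
rewrite cards0 card_affine_line_nondirection // => b bB bL.
by apply: contra PB => bl; rewrite -(uP b).
Qed.

End RedeiType.

(** * Incidence sums and the dual code *)

Section DualCode.

Variables (F : finFieldType) (p : nat).

Lemma dotp_incvec (w : pvec F p) (S : {set pg_point F}) :
  dotp w (incvec p S) = \sum_(x in S) w x.
Proof.
rewrite /dotp [RHS]big_mkcond; apply: eq_bigr => x _; rewrite ffunE.
by case: (x \in S); rewrite ?mulr1 ?mulr0.
Qed.

Lemma sum_incvec (S T : {set pg_point F}) :
  \sum_(x in S) incvec p T x = #|T :&: S|%:R.
Proof.
rewrite -sum1_card natr_sum [LHS]big_mkcond [RHS]big_mkcond; apply: eq_bigr => x _.
by rewrite ffunE inE; case: (x \in S); case: (x \in T).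
Qed.

Lemma in_dual_codeP (w : pvec F p) :
  (forall l, \sum_(x in line_set l) w x = 0) -> in_dual_code w.
Proof.
move=> wl c [a cE]; rewrite /dotp.
transitivity (\sum_l a l * \sum_(x in line_set l) w x); last first.
  by rewrite big1 // => l _; rewrite wl mulr0.
under [RHS]eq_bigr do rewrite -dotp_incvec mulr_sumr.
rewrite exchange_big; apply: eq_bigr => x _; rewrite cE mulr_sumr.
by apply: eq_bigr => l _; rewrite mulrCA.
Qed.

Hypothesis q0 : #|F|%:R = 0 :> 'F_p.

(* Each point other than u lies on exactly one of the lines through u, and u on q + 1 of them. *)
Lemma sum_pencil (w : pvec F p) (u : pg_point F) :
  \sum_(l | incident u l) \sum_(x in line_set l) w x = \sum_x w x.
Proof.
under eq_bigr do rewrite big_mkcond.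
rewrite exchange_big; apply: eq_bigr => x _.
rewrite -big_mkcondr sumr_const -mulr_natr.
suff -> : #|[pred l | incident u l & x \in line_set l]|%:R = 1 :> 'F_p by rewrite mulr1.
have [<-|ux] := eqVneq u x.
  rewrite (_ : #|_| = #|F|.+1) ?mulrSr ?q0 ?add0r //.
  rewrite -(card_line_set u); apply: eq_card => l.
  by rewrite !inE andbb incidentC.
rewrite (eq_card (B := [set l : pg_line F | incident u l & incident x l])).
  by rewrite card_pg_pair.
by move=> l; rewrite !inE.
Qed.

End DualCode.

(** * The codeword and its weight *)

Theorem mainTheorem18 (F : finFieldType) (p h : nat) (k : nat)
  (B : {set pg_point F}) (L : pg_line F) :
  prime p -> (0 < h)%N -> #|F| = (p ^ h)%N ->
  minimal_blocking_set B ->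
  #|B| = (#|F| + k)%N ->
  (2 * k < #|F| + 3)%N ->
  #|B :&: line_set L| = k ->
  in_dual_code (incvec p B - incvec p (line_set L)) /\
  weight (incvec p B - incvec p (line_set L)) = (2 * #|F| + 1 - k)%N.
Proof.
move=> p_pr h0 qE minB cardB ksmall kE.
have pF : p \in [pchar F] := card_finPcharP qE p_pr.
have pFp : p \in [pchar 'F_p] := pchar_Fp p_pr.
have q0 : #|F|%:R = 0 :> 'F_p by rewrite qE natrX (pcharf0 pFp) expr0n (gtn_eqF h0).
have cU : #|B :\: line_set L| = #|F|.
  by have := cardsID (line_set L) B; rewrite kE cardB; lia.
have card_mod (l : pg_line F) : l != L -> #|B :&: line_set l| = 1 %[mod p].
  by apply: (card_small_blocking_set_line (proj1 minB)); rewrite ?kE.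
set w := incvec p B - incvec p (line_set L).
have sum_w (S : {set pg_point F}) :
    \sum_(x in S) w x = #|B :&: S|%:R - #|line_set L :&: S|%:R.
  rewrite -!sum_incvec -sumrB; apply: eq_bigr => x _.
  by rewrite /w !ffunE.
have w_line (l : pg_line F) : l != L -> \sum_(x in line_set l) w x = 0.
  move=> lL; rewrite sum_w; apply/eqP; rewrite subr_eq0.
  have [P /andP[Pl PL] uP] := pg_lines_meet lL.
  have -> : line_set L :&: line_set l = [set P].
    by apply/setP => x; rewrite !inE; apply/andP/eqP => [[xL xl]|->//]; exact: uP.
  by rewrite cards1 -(Fp_nat_mod p_pr) (card_mod l lL) (Fp_nat_mod p_pr).
split.
  apply: in_dual_codeP => l; have [->|] := eqVneq l L; last exact: w_line.
  (* The lines through a point u of U all differ from L, so the pencil at u shows that w has total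
     sum 0. Modulo p this total is k - (q + 1), which is also the sum of w over L. *)
  have /card_gt0P[u uU] : (0 < #|B :\: line_set L|)%N.
    by rewrite cU (ltnW (card_finField_gt1 F)).
  have := sum_pencil q0 w u; rewrite big1 => [|m um]; last first.
    apply: w_line; apply: contraTneq uU => mL; by rewrite !inE -mL um.
  have -> : \sum_x w x = \sum_(x in [set: pg_point F]) w x by apply: eq_bigl => x; rewrite inE.
  rewrite !sum_w !setIT setIid cardB kE card_line_set natrD q0 add0r.
  by move=> <-.
(* The support is the symmetric difference of B and L, with parts of sizes q and q + 1 - k. *)
rewrite /weight; have -> : [set x | w x != 0] =
    (B :\: line_set L) :|: (line_set L :\: B).
  apply/setP => x; rewrite !inE /w !ffunE !inE.
  case: (x \in B); case: (incident x L); rewrite ?subrr ?subr0 ?sub0r ?oppr_eq0 ?eqxx ?oner_neq0 //.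
rewrite cardsU (_ : _ :&: _ = set0) ?cards0 ?subn0; last first.
  by apply/setP => x; rewrite !inE; case: (x \in B); rewrite ?andbF.
have LB := cardsID B (line_set L); rewrite setIC kE card_line_set in LB.
rewrite cU; have arith (q z : nat) : (k + z = q.+1 -> q + z = 2 * q + 1 - k)%N.
  by clear; lia.
exact: arith.
Qed.
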